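(* Let $\Gamma_3^2,\Gamma_3^3$ be the coefficients, depending on $H\in(\tfrac12,1)$, of the projection $\mathbb{E}(\Delta_1\mid\Delta_2,\Delta_3)=\Gamma_3^2\Delta_2+\Gamma_3^3\Delta_3$ for fractional Gaussian noise $(\Delta_k)$ with Hurst index $H$, as defined in the context. Then $$\lim_{H\uparrow1}\Gamma_3^2=\frac{9\log 9-8\log 4}{8\log 4}\approx 0.783083,\qquad \lim_{H\uparrow1}\Gamma_3^3=\frac{8\log 16-9\log 9}{8\log 4}\approx 0.216917.$$
   Context: Let $B^H=\{B^H_t,t\ge0\}$ be a fractional Brownian motion with Hurst index $H\in(\tfrac12,1)$, i.e. a centred Gaussian process with covariance $\tfrac12(t^{2H}+s^{2H}-|t-s|^{2H})$, and let $\Delta_n=B^H_n-B^H_{n-1}$, $n\ge 1$, be its increments (fractional Gaussian noise). They form a stationary Gaussian sequence with autocovariance $\rho_k=\mathbb{E}\Delta_1\Delta_{k+1}=\tfrac12(|k+1|^{2H}-2|k|^{2H}+|k-1|^{2H})$, $k\ge 0$ (so $\rho_0=1$). For $n\ge 2$ the real coefficients $\Gamma_n^k$, $2\le k\le n$, are defined by $\mathbb{E}(\Delta_1\mid\Delta_2,\dots,\Delta_n)=\sum_{k=2}^n\Gamma_n^k\Delta_k$; equivalently, they are the unique solution of the linear system $\rho_{l-1}=\sum_{k=2}^n\Gamma_n^k\rho_{|l-k|}$, $2\le l\le n$ (whose coefficient matrix is nonsingular). $\log$ is the natural logarithm; the decimals are rounded values of the exact expressions. *)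

(* Defs.v *)
From HB Require Import structures.
From mathcomp Require Import all_boot all_order all_algebra.
From mathcomp Require Import all_classical all_reals all_analysis.
Import Order.TTheory GRing.Theory Num.Theory.
Import numFieldNormedType.Exports.

Set Implicit Arguments.
Unset Strict Implicit.
Unset Printing Implicit Defensive.

Local Open Scope classical_set_scope.
Local Open Scope ring_scope.

(* [normal_prob m s] is the N(m, s^2) law only for s != 0; the degenerate
   Gaussian laws are the Dirac masses. *)
Definition gaussian {d : measure_display} {T : measurableType d}
    {R : realType} (P : probability T R) (X : T -> R) : Prop :=
  (exists m s : R, 0 < s /\
     forall U : set R, measurable U -> P (X @^-1` U) = normal_prob m s U) \/
  (exists m : R,
     forall U : set R, measurable U -> P (X @^-1` U) = \d_m U).

Definition gaussian_process {d : measure_display} {T : measurableType d}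
    {R : realType} (P : probability T R) (I : Type) (D : set I)
    (X : I -> {RV P >-> R}) : Prop :=
  forall (n : nat) (t : 'I_n -> I) (a : 'I_n -> R), (forall i, D (t i)) ->
    gaussian P (fun w => \sum_(i < n) a i * X (t i) w).

(* Only the restriction of [B] to nonnegative times is constrained. *)
Definition fractional_brownian_motion {d : measure_display}
    {T : measurableType d} {R : realType} (P : probability T R) (H : R)
    (B : R -> {RV P >-> R}) : Prop :=
  [/\ gaussian_process [set t | 0 <= t] B,
      (forall t : R, 0 <= t -> ('E_P[B t] = 0)%E) &
      (forall s t : R, 0 <= s -> 0 <= t ->
         covariance P (B t) (B s) =
         (2^-1 * (t `^ (2 * H) + s `^ (2 * H) - `|t - s| `^ (2 * H)))%:E)].

(* Meaningful for n >= 1 only. *)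
Definition increment {d : measure_display} {T : measurableType d}
    {R : realType} (P : probability T R) (B : R -> {RV P >-> R})
    (n : nat) : T -> R :=
  fun w => B n%:R w - B n.-1%:R w.

(* [Y] is a version of E(X | G). *)
Definition is_cond_expectation {d : measure_display} {T : measurableType d}
    {R : realType} (P : probability T R) (G : set (set T)) (X Y : T -> R) :
    Prop :=
  [/\ P.-integrable setT (EFin \o X),
      P.-integrable setT (EFin \o Y),
      preimage_set_system setT Y measurable `<=` G &
      forall A, G A ->
        (\int[P]_(w in A) (Y w)%:E = \int[P]_(w in A) (X w)%:E)%E].

Definition sigma_generated {d : measure_display} {T : measurableType d}
    {R : realType} (X : nat -> T -> R) (K : set nat) : set (set T) :=
  <<s \bigcup_(k in K) preimage_set_system setT (X k) measurable >>.

(* E(X_1 | X_2, ..., X_n) = \sum_(2 <= k <= n) g_k X_k almost surely. *)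
Definition projection_coefficients {d : measure_display}
    {T : measurableType d} {R : realType} (P : probability T R)
    (X : nat -> T -> R) (n : nat) (g : nat -> R) : Prop :=
  is_cond_expectation P (sigma_generated X [set k | (2 <= k <= n)%N])
    (X 1%N) (fun w => \sum_(2 <= k < n.+1) g k * X k w).

(* Main.v *)
(* The product (X_1 - E(X_1 | G)) Z has mean 0 for every square integrable
   G-measurable Z; with Z = X_2, X_3 this gives the normal equations, whose
   solution is
     Gamma_2 = rho_1 / (1 + rho_1) * ((1 - rho_2) / (1 - rho_1)),
     Gamma_3 = (rho_1 - Gamma_2) / rho_1.
   At H = 1 the fraction (1 - rho_2) / (1 - rho_1) is of the form 0/0 and
   L'Hopital's rule in H yields its limit. Only the covariance of the process is
   used: square integrability follows from the finiteness of its variances. *)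

Require Import Defs.
From HB Require Import structures.
From mathcomp Require Import all_boot all_order all_algebra.
From mathcomp Require Import all_classical all_reals all_analysis.
From mathcomp Require Import measurable_realfun.
From mathcomp Require Import ring lra zify.
Import Order.TTheory GRing.Theory Num.Theory.
Import numFieldNormedType.Exports.

Local Open Scope classical_set_scope.
Local Open Scope ring_scope.

(** * Numerical values of the limits *)

Lemma ler_ln_expn (R : realType) (a b m n : nat) :
    (0 < a)%N -> (0 < b)%N -> (a ^ m <= b ^ n)%N ->
  m%:R * ln (a%:R : R) <= n%:R * ln (b%:R : R).
Proof.
move=> a0 b0; rewrite -(ler_nat R) !natrX => le_ab.
by rewrite !mulr_natl -!lnXn ?ltr0n// ler_ln// posrE exprn_gt0// ltr0n.
Qed.

(* 1054/665 and 3647/2301 enclose the binary logarithm of 3: the former is a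
   convergent of its continued fraction, the latter a semiconvergent. *)
Lemma ln3_bounds (R : realType) :
  1054 * ln (2 : R) <= 665 * ln 3 /\ 2301 * ln (3 : R) <= 3647 * ln 2.
Proof.
split; [apply: (@ler_ln_expn R 2 3 1054 665 isT isT)|
  apply: (@ler_ln_expn R 3 2 2301 3647 isT isT)]; lia.
Qed.

Lemma ln4_gt0 (R : realType) : 0 < ln (4 : R).
Proof. by rewrite ln_gt0// ltr1n. Qed.

(** The quotient equals [9 / 8 * (ln 3 / ln 2) - 1], and the enclosure of [ln 3 / ln 2] is narrow
    enough for half a unit of the sixth decimal. *)
Lemma L2_approx (R : realType) :
  `|(9 * ln 9 - 8 * ln 4) / (8 * ln 4) - (783 / 10 ^+ 3 + 83 / 10 ^+ 6)| <=
  5 / 10 ^+ 7 :> R.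
Proof.
have [lo hi] := ln3_bounds R.
have l2 : 0 < ln (2 : R) by rewrite ln_gt0// ltr1n.
have -> : ln (9 : R) = 2 * ln 3.
  by rewrite mulr_natl -lnXn//; congr ln; ring.
have -> : ln (4 : R) = 2 * ln 2.
  by rewrite mulr_natl -lnXn//; congr ln; ring.
set r := ln 3 in lo hi *.
set l := ln 2 in l2 lo hi *.
have -> : (9 * (2 * r) - 8 * (2 * l)) / (8 * (2 * l)) = 9 / 8 * (r / l) - 1.
  by field; rewrite gt_eqF.
have lo' : 1054 / 665 <= r / l by rewrite ler_pdivlMr//; lra.
have hi' : r / l <= 3647 / 2301 by rewrite ler_pdivrMr//; lra.
by rewrite ler_norml; apply/andP; split; lra.
Qed.

Lemma L3_eq1BL2 (R : realType) :
  (8 * ln 16 - 9 * ln 9) / (8 * ln 4) =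
  1 - (9 * ln 9 - 8 * ln 4) / (8 * ln 4) :> R.
Proof.
have -> : ln (16 : R) = 2 * ln 4.
  by rewrite mulr_natl -lnXn//; congr ln; ring.
by field; rewrite gt_eqF// ln4_gt0.
Qed.

(** * The autocovariances as functions of [H], near [H = 1] *)

(* Meaningful for k >= 1 only, because of the truncated predecessor. *)
Definition fgn_autocov {R : realType} (H : R) (k : nat) : R :=
  2^-1 * (k.+1%:R `^ (2 * H) - 2 * k%:R `^ (2 * H) + k.-1%:R `^ (2 * H)).

(** For [a > 0] the power is [expR (c * ln a * H)], so the chain rule applies. The exponent is the
    variable in L'Hopital's rule. *)
Lemma is_derive_powR_exponent (R : realType) (a c x : R) : 0 < a ->
  is_derive x 1 (fun H => a `^ (c * H)) (c * ln a * a `^ (c * x)).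
Proof.
move=> a0.
have -> : (fun H => a `^ (c * H)) = expR \o ( *%R (c * ln a)).
  by apply/funext => H /=; rewrite /powR gt_eqF//; congr expR; ring.
rewrite (_ : c * ln a * _ = expR (c * ln a * x) * (c * ln a)); last first.
  by rewrite mulrC /powR gt_eqF//; congr (expR _ * _); ring.
apply: (@is_derive1_comp _ expR).
have -> : *%R (c * ln a) = (c * ln a) \*: (@id R) by [].
by apply: is_derive_eq; exact: mulr1.
Qed.

Lemma fgn_autocov1 (R : realType) (H : R) : 0 < H ->
  fgn_autocov H 1 = 2^-1 * 2 `^ (2 * H) - 1.
Proof.
(* As [powR 0 0] is [1], the term with base [0] vanishes only because [2 * H] is nonzero. *)
move=> H0; rewrite /fgn_autocov/= powR1 powR0 ?mulf_neq0 ?gt_eqF//.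
by field.
Qed.

Lemma fgn_autocov2 (R : realType) (H : R) :
  fgn_autocov H 2 = 2^-1 * (3 `^ (2 * H) - 2 * 2 `^ (2 * H) + 1).
Proof. by rewrite /fgn_autocov/= powR1. Qed.

(** The bounds come from [0 < powR 2 (2 * H) < 4]. They make the determinant [1 - rho_1 ^ 2] of the
    normal equations nonzero. *)
Lemma fgn_autocov1_lt1 (R : realType) (H : R) : 0 < H < 1 ->
  -1 < fgn_autocov H 1 < 1.
Proof.
move=> /andP[H0 H1]; rewrite fgn_autocov1//.
have : 2 `^ (2 * H) < (2 : R) `^ (2 * 1).
  by rewrite /powR gt_eqF// ltr_expR ltr_pM2r ?ln_gt0 ?ltr1n// ltr_pM2l.
rewrite mulr1 powR_mulrn// => h.
have : 0 < 2 `^ (2 * H) :> R by rewrite powR_gt0.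
by move=> ?; apply/andP; split; lra.
Qed.

Lemma cvg_powR_exponent (R : realType) (a c x : R) : 0 < a ->
  a `^ (c * H) @[H --> x^'-] --> a `^ (c * x).
Proof.
move=> a0; apply: cvg_at_left_filter.
have := @is_derive_powR_exponent R a c x a0.
by move=> [/derivable1_diffP/differentiable_continuous + _]; exact.
Qed.

Lemma cvg_fgn_autocov1 (R : realType) :
  fgn_autocov H 1 @[H --> (1 : R)^'-] --> (1 : R).
Proof.
have : 2^-1 * 2 `^ (2 * H) - 1 @[H --> (1 : R)^'-] -->
    (2^-1 * 2 `^ (2 * 1) - 1 : R).
  apply: cvgB; last exact: cvg_cst.
  by apply: cvgM; [exact: cvg_cst|exact: cvg_powR_exponent].
rewrite (_ : 2^-1 * 2 `^ (2 * 1) - 1 = 1 :> R); last first.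
  by rewrite mulr1 powR_mulrn//; lra.
apply: cvg_trans; apply: near_eq_cvg; near=> H.
have H0 : 0 < H by near: H; exact: nbhs_left_gt.
by rewrite fgn_autocov1.
Unshelve. all: by end_near. Qed.

Lemma cvg_fgn_autocov_ratio (R : realType) :
  (1 - fgn_autocov H 2) / (1 - fgn_autocov H 1) @[H --> (1 : R)^'-] -->
  (9 * ln 9 - 8 * ln 4) / (4 * ln 4).
Proof.
(* For [H > 0] the closed forms [f] and [g] are [1 - rho_2] and [1 - rho_1]; their derivatives are
   [df] and [dg]. *)
pose f (H : R) := 1 - 2^-1 * (3 `^ (2 * H) - 2 * 2 `^ (2 * H) + 1).
pose g (H : R) := 2 - 2^-1 * 2 `^ (2 * H).
pose df (H : R) := ln 4 * 2 `^ (2 * H) - ln 3 * 3 `^ (2 * H).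
pose dg (H : R) := - (ln 2 * 2 `^ (2 * H)).
suff : f H / g H @[H --> (1 : R)^'-] --> (9 * ln 9 - 8 * ln 4) / (4 * ln 4).
  apply: cvg_trans; apply: near_eq_cvg; near=> H.
  have H0 : 0 < H by near: H; exact: nbhs_left_gt.
  by rewrite fgn_autocov2 fgn_autocov1// /f /g; congr (_ / _); lra.
have ln9 : ln (9 : R) = 2 * ln 3.
  by rewrite mulr_natl -lnXn//; congr ln; ring.
have ln4 : ln (4 : R) = 2 * ln 2.
  by rewrite mulr_natl -lnXn//; congr ln; ring.
have l2 : 0 < ln (2 : R) by rewrite ln_gt0// ltr1n.
have p2 : (2 : R) `^ (2 * 1) = 4 by rewrite mulr1 powR_mulrn//; lra.
have p3 : (3 : R) `^ (2 * 1) = 9 by rewrite mulr1 powR_mulrn//; lra.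
have d2 x := @is_derive_powR_exponent R 2 2 x ltac:(by []).
have d3 x := @is_derive_powR_exponent R 3 2 x ltac:(by []).
have c2 := @cvg_powR_exponent R 2 2 1 ltac:(by []).
have c3 := @cvg_powR_exponent R 3 2 1 ltac:(by []).
(* The left endpoint [0] is arbitrary: the derivatives exist everywhere and [dg] never vanishes. At
   [H = 1] the powers are [4] and [9], so [f] and [g] both tend to [0]. *)
apply: (@lhopital_at_left R f df g dg 0 1); first by [].
- move=> x _.
  have -> : f = cst 2^-1 + (- 2^-1) \*: (fun H => 3 `^ (2 * H)) +
      (fun H => 2 `^ (2 * H)).
    by apply/funext => H; rewrite /f !fctE /= /GRing.scale/=; lra.
  by apply: is_derive_eq; rewrite /df ln4 /GRing.scale/=; lra.
- move=> x _.
  have -> : g = cst 2 + (- 2^-1) \*: (fun H => 2 `^ (2 * H)).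
    by apply/funext => H; rewrite /g !fctE /= /GRing.scale/=; lra.
  by apply: is_derive_eq; rewrite /dg /GRing.scale/=; lra.
- have : f H @[H --> 1^'-] --> 1 - 2^-1 * (3 `^ (2 * 1) - 2 * 2 `^ (2 * 1) + 1).
    apply: cvgB; first exact: cvg_cst.
    apply: cvgM; first exact: cvg_cst.
    apply: cvgD; last exact: cvg_cst.
    by apply: cvgB => //; apply: cvgM => //; exact: cvg_cst.
  by rewrite p2 p3 (_ : 1 - _ = 0)//; lra.
- have : g H @[H --> 1^'-] --> 2 - 2^-1 * 2 `^ (2 * 1).
    apply: cvgB; first exact: cvg_cst.
    by apply: cvgM => //; exact: cvg_cst.
  by rewrite p2 (_ : 2 - _ = 0)//; lra.
- by move=> x _; rewrite oppr_eq0 mulf_neq0 ?gt_eqF ?powR_gt0.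
- have : df H / dg H @[H --> 1^'-] -->
      (ln 4 * 2 `^ (2 * 1) - ln 3 * 3 `^ (2 * 1)) / - (ln 2 * 2 `^ (2 * 1)).
    apply: cvgM.
      by apply: cvgB; (apply: cvgM; [exact: cvg_cst|]).
    apply: cvgV; first by rewrite p2 oppr_eq0 mulf_neq0 ?gt_eqF.
    by apply: cvgN; apply: cvgM; [exact: cvg_cst|].
  rewrite p2 p3 ln9 ln4 (_ : _ / - (ln 2 * 4) =
      (9 * (2 * ln 3) - 8 * (2 * ln 2)) / (4 * (2 * ln 2)))//.
  by field; rewrite gt_eqF.
Unshelve. all: by end_near. Qed.

(** * Orthogonality of the residual of a conditional expectation *)

Import HBNNSimple.

(** The composite of [g] and [Z] is a finite combination of indicators of preimages under [Z], and
    [D] integrates to [0] over each of them. *)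
Lemma integral_mul_nnsfun_comp_eq0 d (T : measurableType d) (R : realType)
    (mu : {measure set T -> \bar R}) (D Z : T -> R) (g : {nnsfun R >-> R}) :
    mu.-integrable setT (EFin \o D) -> measurable_fun setT Z ->
    (forall U, measurable U -> (\int[mu]_(x in Z @^-1` U) (D x)%:E = 0)%E) ->
  (\int[mu]_x (D x * g (Z x))%:E = 0)%E.
Proof.
move=> iD mZ D0.
have mA U : measurable U -> measurable (Z @^-1` U).
  by move=> mU; rewrite -[X in measurable X]setTI; exact: mZ.
have mgA y : measurable (g @^-1` [set y]).
  by rewrite -[X in measurable X]setTI; exact: measurable_funP.
have [s gE] : exists s : seq R,
    forall z, g z = \sum_(y <- s) y * \1_(g @^-1` [set y]) z.
  by eexists => z; rewrite fimfunE fsbig_finite.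
pose A y := Z @^-1` (g @^-1` [set y]).
have iDA y : mu.-integrable setT (EFin \o D \_ (A y)).
  have := @integrable_mkcond _ _ _ mu (A y) (EFin \o D) (mA _ (mgA _)).
  rewrite restrict_EFin => -[+ _]; apply.
  exact: (@integrableS _ _ _ mu setT (A y)) (mA _ (mgA _)) _ iD.
under eq_integral => x _.
  rewrite (_ : (D x * g (Z x))%:E =
      (\sum_(y <- s) y%:E * (D \_ (A y) x)%:E)%E); last first.
    rewrite gE mulr_sumr -sumEFin; apply: eq_bigr => y _.
    rewrite -EFinM; congr EFin; rewrite patchE indicE mulrCA.
    have -> : (Z x \in g @^-1` [set y]) = (x \in A y) by [].
    by case: ifPn => _ /=; rewrite ?mulr1 ?mulr0.
  over.
rewrite integral_sum//=; last first.
  by move=> y; apply: integrableZl => //; exact: iDA.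
rewrite big1// => y _; rewrite integralZl//; last exact: iDA.
rewrite -[X in integral _ _ X]/(EFin \o D \_ (A y)) -restrict_EFin.
by rewrite -integral_mkcond D0 ?mule0.
Qed.

(** Nonnegativity of [h] allows its approximation from below by simple functions; dominated
    convergence, with the absolute value of [D * h (Z)] as bound, passes to the limit. *)
Lemma integral_mul_comp_eq0 d (T : measurableType d) (R : realType)
    (mu : {measure set T -> \bar R}) (D Z : T -> R) (h : R -> R) :
    mu.-integrable setT (EFin \o D) -> measurable_fun setT Z ->
    measurable_fun setT h -> (forall z, 0 <= h z) ->
    mu.-integrable setT (fun x => (D x * h (Z x))%:E) ->
    (forall U, measurable U -> (\int[mu]_(x in Z @^-1` U) (D x)%:E = 0)%E) ->
  (\int[mu]_x (D x * h (Z x))%:E = 0)%E.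
Proof.
move=> iD mZ mh h0 iDh D0.
have mEh : measurable_fun setT (EFin \o h) by exact/measurable_EFinP.
have Eh0 z : setT z -> (0 <= (EFin \o h) z)%E by move=> _; rewrite lee_fin h0.
pose g n := nnsfun_approx measurableT mEh n.
have mD : measurable_fun setT D.
  by apply/measurable_EFinP; exact: measurable_int iD.
have : (\int[mu]_x (D x * g n (Z x))%:E @[n --> \oo] -->
        \int[mu]_x (D x * h (Z x))%:E)%E.
  apply: (@dominated_cvg _ _ _ mu setT measurableT _ _
    (fun x => `|(D x * h (Z x))%:E|)%E) => //.
  - move=> n; apply/measurable_EFinP; apply: measurable_funM => //.
    by apply: measurableT_comp.
  - move=> x _; under eq_fun do rewrite EFinM.
    rewrite EFinM; apply: cvgeZl => //.
    exact: (@cvg_nnsfun_approx _ _ _ _ measurableT _ mEh Eh0).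
  - exact: integrable_abse.
  - move=> n x _; rewrite lee_fin !normrM ler_wpM2l// !ger0_norm//.
    rewrite /g nnsfun_approxE -lee_fin.
    exact: (@le_approx _ _ _ setT (EFin \o h) n (Z x) Eh0).
under eq_fun do rewrite integral_mul_nnsfun_comp_eq0//.
move=> /cvg_lim <-//; apply: lim_cst => //.
Qed.

(** The residual integrates to [0] over every event determined by [Z], as such events belong to [G].
    Splitting [Z] into positive and negative parts reduces the claim to nonnegative functions of
    [Z]. *)
Lemma cond_expectation_orthogonal d (T : measurableType d) (R : realType)
    (P : probability T R) (G : set (set T)) (X Y Z : T -> R) :
    is_cond_expectation P G X Y -> measurable_fun setT Z ->
    preimage_set_system setT Z measurable `<=` G ->
    ((X \- Y) \* Z)%R \in Lfun P 1 ->
  ('E_P[((X \- Y) \* Z)%R] = 0)%E.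
Proof.
move=> [iX iY _ XY] mZ ZG /Lfun1_integrable iDZ.
have iD : P.-integrable setT (EFin \o (X \- Y)%R) .
  exact: (integrableB measurableT iX iY).
have D0 U : measurable U -> (\int[P]_(x in Z @^-1` U) ((X \- Y)%R x)%:E = 0)%E.
  move=> mU; have mZU : measurable (Z @^-1` U).
    by rewrite -[X in measurable X]setTI; exact: mZ.
  rewrite integralB_EFin//; try exact: (@integrableS _ _ _ P setT).
  rewrite XY ?subee//.
    by apply: integrable_fin_num => //; exact: (@integrableS _ _ _ P setT).
  by apply: ZG; exists U => //; rewrite setTI.
have mD : measurable_fun setT (X \- Y)%R.
  by apply/measurable_EFinP; exact: measurable_int iD.
(* Domination by the integrable product with [Z] itself; this serves both parts of [Z]. *)
have ile (h : R -> R) : measurable_fun setT h -> (forall z, `|h z| <= `|z|) ->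
    P.-integrable setT (fun x => ((X \- Y)%R x * h (Z x))%:E).
  move=> mh hz; apply: le_integrable iDZ => //.
    by apply/measurable_EFinP; apply: measurable_funM => //;
      exact: measurableT_comp.
  by move=> x _; rewrite lee_fin !normrM ler_wpM2l.
pose pos (z : R) := Num.max z 0.
pose neg (z : R) := Num.max (- z) 0.
have mpos : measurable_fun setT pos by exact: measurable_maxr.
have mneg : measurable_fun setT neg by exact: measurable_maxr.
have pos0 z : 0 <= pos z by rewrite le_max lexx orbT.
have neg0 z : 0 <= neg z by rewrite le_max lexx orbT.
have ipos : P.-integrable setT (fun x => ((X \- Y)%R x * pos (Z x))%:E).
  apply: ile => // z; rewrite ger0_norm// /pos; case: (leP z 0) => //.
  by move=> z0; rewrite ler_norm.
have ineg : P.-integrable setT (fun x => ((X \- Y)%R x * neg (Z x))%:E).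
  apply: ile => // z; rewrite ger0_norm// /neg; case: (leP (- z) 0) => //.
  by move=> z0; rewrite -normrN ler_norm.
rewrite unlock; transitivity
  (\int[P]_x ((X \- Y)%R x * pos (Z x) - (X \- Y)%R x * neg (Z x))%:E)%E.
  apply: eq_integral => x _; rewrite -mulrBr; congr (_ * _)%:E.
  by rewrite /pos /neg; case: (leP (Z x) 0); case: (leP (- Z x) 0); lra.
rewrite (@integralB_EFin _ _ _ P setT (fun x => (X \- Y)%R x * pos (Z x))
   (fun x => (X \- Y)%R x * neg (Z x)))//.
by rewrite !integral_mul_comp_eq0// subee.
Qed.

(** * Covariances of the increments and the normal equations *)

(** For centred [X] this covariance is the integral of [X ^ 2], possibly [+oo], so its finiteness is
    square integrability. *)
Lemma covariance_finite_Lfun2 d (T : measurableType d) (R : realType)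
    (P : probability T R) (X : {RV P >-> R}) :
    ('E_P[X] = 0)%E -> (covariance P X X < +oo)%E ->
  (X : T -> R) \in Lfun P 2%:E.
Proof.
move=> X0; rewrite unlock X0 fine0 unlock => Xoo.
rewrite inE; apply/andP; split; rewrite inE//= /finite_norm unlock.
apply: poweR_lty; apply: le_lt_trans Xoo; rewrite le_eqVlt; apply/orP; left.
apply/eqP; apply: eq_integral => x _ /=.
rewrite powR_mulrn// real_normK ?num_real//.
by rewrite !fctE/= subr0 expr2.
Qed.

Section fractional_gaussian_noise.
Context d (T : measurableType d) (R : realType) (P : probability T R) (H : R)
  (B : R -> {RV P >-> R}).
Hypotheses (H0 : 0 < H) (fbmB : fractional_brownian_motion H B).

Let Lfun2B (t : R) : 0 <= t -> (B t : T -> R) \in Lfun P 2%:E.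
Proof.
case: fbmB => _ EB CB t0; apply: covariance_finite_Lfun2; first exact: EB.
by rewrite CB// ltry.
Qed.

Lemma increment_Lfun2 (n : nat) : increment B n \in Lfun P 2%:E.
Proof.
by apply: rpredB => [|?|?]; [rewrite lee_fin ler1n|exact: Lfun2B..].
Qed.

Lemma expectation_increment (n : nat) : ('E_P[increment B n] = 0)%E.
Proof.
case: fbmB => _ EB _.
rewrite -[increment _ _]/(B n%:R \- B n.-1%:R) expectationB.
- by rewrite !EB// sube0.
- by apply: Lfun_subset12; [exact: fin_num_measure|apply: Lfun2B].
- by apply: Lfun_subset12; [exact: fin_num_measure|apply: Lfun2B].
Qed.

(** By bilinearity; the powers of single times cancel and only those of time differences remain. *)
Let covariance_increment (m n : nat) :
  covariance P (increment B m.+1) (increment B n.+1) =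
  (2^-1 * (`|m.+1%:R - n%:R| `^ (2 * H) + `|m%:R - n.+1%:R| `^ (2 * H)
    - `|m.+1%:R - n.+1%:R| `^ (2 * H) - `|m%:R - n%:R| `^ (2 * H)))%:E.
Proof.
case: fbmB => _ _ CB.
have L2 k := Lfun2B _ (ler0n R k).
rewrite -[increment B m.+1]/(B m.+1%:R \- B m%:R).
rewrite -[increment B n.+1]/(B n.+1%:R \- B n%:R).
have L2B : (B n.+1%:R \- B n%:R)%R \in Lfun P 2%:E.
  exact: (increment_Lfun2 n.+1).
rewrite covarianceBl// !covarianceBr//.
rewrite !CB// -!EFinB; congr EFin; ring.
Qed.

Lemma variance_increment (n : nat) :
  covariance P (increment B n.+1) (increment B n.+1) = 1%E.
Proof.
rewrite covariance_increment !subrr normr0 powR0 ?mulf_neq0 ?gt_eqF//.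
have -> : n.+1%:R - n%:R = 1 :> R by ring.
have -> : n%:R - n.+1%:R = - 1 :> R by ring.
rewrite normrN normr1 powR1; by congr EFin; field.
Qed.

(** At [k = 0] the truncated predecessor makes [fgn_autocov] equal to [1 / 2] instead of [1], so
    variances are treated separately. *)
Lemma covariance_increment_autocov (n k : nat) : (0 < k)%N ->
  covariance P (increment B n.+1) (increment B (n + k).+1) =
  (fgn_autocov H k)%:E.
Proof.
case: k => // k _; rewrite covariance_increment /fgn_autocov.
have -> : n.+1%:R - (n + k.+1)%:R = - k%:R :> R by rewrite addnS; ring.
have -> : n%:R - (n + k.+1).+1%:R = - k.+2%:R :> R by rewrite addnS; ring.
have -> : n.+1%:R - (n + k.+1).+1%:R = - k.+1%:R :> R by rewrite addnS; ring.
have -> : n%:R - (n + k.+1)%:R = - k.+1%:R :> R by rewrite addnS; ring.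
rewrite !normrN !ger0_norm//; congr EFin; ring.
Qed.

Lemma normal_equation (g : nat -> R) (n k : nat) : (2 <= k <= n)%N ->
    projection_coefficients P (increment B) n g ->
  covariance P (increment B 1) (increment B k) =
  (\sum_(2 <= l < n.+1)
     (g l)%:E * covariance P (increment B l) (increment B k))%E.
Proof.
move=> kn pg; pose Y := \sum_(2 <= l < n.+1) g l *: increment B l.
have YE : (fun w => \sum_(2 <= l < n.+1) g l * increment B l w) = Y.
  by apply/funext => w; rewrite /Y fct_sumE.
have le12 : (1 <= 2%:E :> \bar R)%E by rewrite lee_fin ler1n.
have L2Z l : (g l *: increment B l) \in Lfun P 2%:E.
  rewrite (_ : _ *: _ = g l \o* increment B l).
    by apply: Lfun_scale; [rewrite ler1n|exact: increment_Lfun2].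
  by apply/funext => w /=; rewrite mulrC.
have L2Y : Y \in Lfun P 2%:E by apply: rpred_sum.
have L2D : (increment B 1 \- Y)%R \in Lfun P 2%:E.
  by apply: rpredB => // *; exact: increment_Lfun2.
have L2 := increment_Lfun2.
have L2k := L2 k.
have L1DZ := Lfun2_mul_Lfun1 L2D L2k.
have Pfin : P setT \is a fin_num := fin_num_measure P _ measurableT.
move: pg; rewrite /projection_coefficients YE.
move=> /cond_expectation_orthogonal => /(_ (increment B k)) orth.
have : covariance P (increment B 1 \- Y)%R (increment B k) = 0%E.
  rewrite (covarianceE (Lfun_subset12 Pfin L2D) (Lfun_subset12 Pfin L2k))//.
  rewrite expectation_increment mule0 sube0; apply: orth => //.
    by move: L2k; rewrite inE => /andP[]; rewrite inE.
  apply: subset_trans (@sub_sigma_algebra _ _ _).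
  by move=> A XA; exists k.
rewrite (covarianceBl (L2 1%N) L2Y L2k).
have covY s :
    covariance P (\sum_(l <- s) g l *: increment B l) (increment B k) =
    (\sum_(l <- s) (g l)%:E * covariance P (increment B l) (increment B k))%E.
  elim: s => [|l s IHs]; first by rewrite !big_nil covariance_cst_l.
  rewrite !big_cons (covarianceDl (L2Z l) _ L2k) ?IHs//; last exact: rpred_sum.
  congr (_ + _)%E.
  rewrite (_ : _ *: _ = g l \o* increment B l).
    apply: covarianceZl; [exact: Lfun_subset12..|].
    exact: Lfun2_mul_Lfun1.
  by apply/funext => w /=; rewrite mulrC.
(* Finiteness is what turns [x - y = 0] into [x = y] in the extended reals. *)
have cov_fin W : W \in Lfun P 2%:E ->
    covariance P W (increment B k) \is a fin_num.
  move=> L2W; apply: covariance_fin_num; [exact: Lfun_subset12..|].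
  exact: Lfun2_mul_Lfun1.
rewrite -covY => /eqP; rewrite sube_eq ?cov_fin ?fin_num_adde_defl ?cov_fin//.
by rewrite add0e => /eqP.
Qed.

End fractional_gaussian_noise.

(** * The two coefficients and their limits *)

(** With [a = rho_1] and [b = rho_2] the normal equations are [a = g 2 + a * g 3] and
    [b = a * g 2 + g 3]. The solution for [g 2] is factored so as to isolate the fraction that is
    0/0 at [H = 1]. *)
Lemma projection3_fgn d (T : measurableType d) (R : realType)
    (P : probability T R) (H : R) (B : R -> {RV P >-> R}) (g : nat -> R) :
    0 < H < 1 -> fractional_brownian_motion H B ->
    projection_coefficients P (increment B) 3 g ->
  g 2%N = fgn_autocov H 1 / (1 + fgn_autocov H 1) *
          ((1 - fgn_autocov H 2) / (1 - fgn_autocov H 1)) /\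
  g 2%N + fgn_autocov H 1 * g 3%N = fgn_autocov H 1.
Proof.
move=> H01 fbmB pg; have /andP[H0 _] := H01.
have /andP[r1N r1] := fgn_autocov1_lt1 _ _ H01.
have := normal_equation _ _ _ _ _ _ fbmB g 3 2 isT pg.
have := normal_equation _ _ _ _ _ _ fbmB g 3 3 isT pg.
have sum3 (F : nat -> \bar R) :
    (\sum_(2 <= l < 4) F l = F 2%N + F 3%N)%E by rewrite big_ltn// big_nat1.
have var k := @variance_increment _ _ _ _ _ _ H0 fbmB k.
rewrite !sum3 !var !mule1.
rewrite (covarianceC P (increment B 3)).
rewrite (@covariance_increment_autocov _ _ _ _ _ _ fbmB 0 1 isT).
rewrite (@covariance_increment_autocov _ _ _ _ _ _ fbmB 0 2 isT).
rewrite (@covariance_increment_autocov _ _ _ _ _ _ fbmB 1 1 isT).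
rewrite -!EFinM -!EFinD => -[e3] [e2]; split; last by rewrite mulrC -e2.
set a := fgn_autocov H 1 in e2 e3 r1N r1 *.
set b := fgn_autocov H 2 in e3 *.
have da : 1 - a != 0 by rewrite gt_eqF//; lra.
have da' : 1 + a != 0 by rewrite gt_eqF//; lra.
(* After multiplication by the determinant [(1 - a) * (1 + a)], the combination [e2 - a * e3]
   eliminates [g 3]. *)
apply: (mulfI da'); apply: (mulfI da).
rewrite (_ : (1 - a) * ((1 + a) * g 2%N) = a - a * b).
  by field; rewrite da da'.
by nra.
Qed.

Theorem proposition2p10 (R : realType) (d : R -> measure_display)
    (T : forall H : R, measurableType (d H))
    (P : forall H : R, probability (T H) R)
    (B : forall H : R, R -> {RV (P H) >-> R})
    (Gamma3 : R -> nat -> R)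
    (fbmB : forall H : R, 2^-1 < H < 1 -> fractional_brownian_motion H (B H))
    (projGamma3 : forall H : R, 2^-1 < H < 1 ->
       projection_coefficients (P H) (increment (B H)) 3 (Gamma3 H)) :
  let L2 : R := (9 * ln 9 - 8 * ln 4) / (8 * ln 4) in
  let L3 : R := (8 * ln 16 - 9 * ln 9) / (8 * ln 4) in
  [/\ Gamma3 H 2%N @[H --> 1^'-] --> L2,
      Gamma3 H 3%N @[H --> 1^'-] --> L3,
      `|L2 - (783 / 10 ^+ 3 + 83 / 10 ^+ 6)| <= 5 / 10 ^+ 7 &
      `|L3 - (216 / 10 ^+ 3 + 917 / 10 ^+ 6)| <= 5 / 10 ^+ 7].
Proof.
move=> L2 L3.
have L3E : L3 = 1 - L2 by exact: L3_eq1BL2.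
have L2approx : `|L2 - (783 / 10 ^+ 3 + 83 / 10 ^+ 6)| <= 5 / 10 ^+ 7.
  exact: L2_approx.
have a_cvg := cvg_fgn_autocov1 R.
have proj H : 2^-1 < H < 1 ->
    Gamma3 H 2%N = fgn_autocov H 1 / (1 + fgn_autocov H 1) *
          ((1 - fgn_autocov H 2) / (1 - fgn_autocov H 1)) /\
    Gamma3 H 2%N + fgn_autocov H 1 * Gamma3 H 3%N = fgn_autocov H 1.
  move=> H1; apply: (@projection3_fgn _ _ _ (P H) H (B H)).
  - by move: H1 => /andP[h1 ->]; rewrite andbT (lt_trans _ h1)// invr_gt0.
  - exact: fbmB.
  - exact: projGamma3.
have G2 : Gamma3 H 2%N @[H --> 1^'-] --> L2.
  (* The factor [rho_1 / (1 + rho_1)] tends to [1 / 2], which turns the denominator [4 * ln 4] into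
     [8 * ln 4]. *)
  have -> : L2 = 1 / (1 + 1) * ((9 * ln 9 - 8 * ln 4) / (4 * ln 4)).
    by rewrite /L2; field; rewrite gt_eqF// ln4_gt0.
  apply: (@cvg_trans _ (fgn_autocov H 1 / (1 + fgn_autocov H 1) *
      ((1 - fgn_autocov H 2) / (1 - fgn_autocov H 1)) @[H --> 1^'-])).
    apply: near_eq_cvg; near=> H.
    have /proj[-> //] : 2^-1 < H < 1.
    by apply/andP; split; near: H;
      [apply: nbhs_left_gt; rewrite invf_lt1// ltr1n|exact: nbhs_left_lt].
  apply: cvgM; last exact: cvg_fgn_autocov_ratio.
  apply: cvgM => //; apply: cvgV => //.
  by apply: cvgD => //; exact: cvg_cst.
split=> //.
(* The first normal equation can be solved for [Gamma3 H 3] near [1], where [rho_1] is nonzero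
   because its limit is [1]. *)
- apply: (@cvg_trans _ ((fgn_autocov H 1 - Gamma3 H 2%N) / fgn_autocov H 1
      @[H --> 1^'-])).
    apply: near_eq_cvg; near=> H.
    have a0 : fgn_autocov H 1 != 0 by near: H; exact: cvgr_neq0 a_cvg _.
    have /proj[_ e] : 2^-1 < H < 1.
      by apply/andP; split; near: H;
        [apply: nbhs_left_gt; rewrite invf_lt1// ltr1n|exact: nbhs_left_lt].
    apply: (mulfI a0); rewrite mulrC divfK// -[X in X - _]e.
    by rewrite addrAC subrr add0r.
  rewrite L3E -[1 - L2]divr1.
  by apply: cvgM; [exact: cvgB|exact: cvgV].
(* The decimals [0.783083] and [0.216917] add up to [1], as do [L2] and [L3], so the error bound
   carries over. *)
- by move: L2approx; rewrite L3E !ler_norml => /andP[? ?];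
    apply/andP; split; lra.
Unshelve. all: by end_near. Qed.
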